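(* Let $G=(V,E)$ be a connected, locally finite infinite network with conductance function $c$ and base point $o\in V$, and let $\mathscr{H}$ be its energy Hilbert space, i.e. the reproducing kernel Hilbert space of the kernel $k^{(c)}(x,y)=\langle v_x,v_y\rangle_{\mathscr{H}}$. Let $x\in V\setminus\{o\}$. Then $\delta_x\in\mathscr{H}$, and $$\Vert\delta_x\Vert_{\mathscr{H}}^2=\sum_{y\sim x}c_{xy}=:c(x).$$
   Context: Setting. $V$ is a countably infinite set, $E\subset V\times V\setminus(\text{diagonal})$ is symmetric, and $c:E\to(0,\infty)$ satisfies $c_{xy}=c_{yx}$. Write $y\sim x$ if $(x,y)\in E$. Each $x\in V$ has only finitely many neighbors. A base point $o\in V$ is fixed, and $G$ is connected: for every $x\in V\setminus\{o\}$ there are edges $(x_i,x_{i+1})\in E$, $0\le i\le n-1$, with $x_0=o$, $x_n=x$. The energy Hilbert space $\mathscr{H}$ consists of all functions $f:V\to\mathbb{C}$ with $f(o)=0$ and $\|f\|_{\mathscr{H}}^2=\frac12\sum_{(x,y)\in E}c_{xy}|f(x)-f(y)|^2<\infty$, with inner product $\langle h,f\rangle_{\mathscr{H}}=\frac12\sum_{(x,y)\in E}c_{xy}(\overline{h(x)}-\overline{h(y)})(f(x)-f(y))$. For each $x\in V$ the dipole $v_x\in\mathscr{H}$ is the unique vector with $\langle v_x,f\rangle_{\mathscr{H}}=f(x)-f(o)$ for all $f\in\mathscr{H}$. $\delta_x$ is the function on $V$ equal to $1$ at $x$ and $0$ elsewhere. *)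

(* Defs.v *)
From mathcomp Require Export all_boot all_order all_algebra.
From mathcomp Require Export complex.
From mathcomp Require Export all_classical all_reals all_analysis.

Set Implicit Arguments.
Unset Strict Implicit.
Unset Printing Implicit Defensive.

Import Order.TTheory GRing.Theory Num.Theory.

Local Open Scope classical_set_scope.
Local Open Scope ring_scope.

(* The conductance is a total function on V * V; its values off the edge set
   are unconstrained and are never used below. *)
Record network (R : realType) (V : countType) := Network {
  adj : rel V;
  conductance : V -> V -> R;
  base : V;
  network_infinite : infinite_set [set: V];
  adj_irr : irreflexive adj;
  adj_sym : symmetric adj;
  conductance_gt0 : forall x y, adj x y -> 0 < conductance x y;
  conductance_sym : forall x y, adj x y -> conductance x y = conductance y x;
  adj_finite : forall x, finite_set [set y | adj x y];
  adj_connected : forall x, x != base ->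
    exists p : seq V, path adj base p /\ last base p = x
}.

Section EnergySpace.
Variables (R : realType) (V : countType) (G : network R V).

Definition edges : set (V * V) := [set p | adj G p.1 p.2].

(* Each undirected edge is counted twice, once per orientation. *)
Definition energy (f : V -> R[i]) : \bar R :=
  ((2^-1)%:E * \esum_(p in edges)
     (conductance G p.1 p.2 * Normc.normc (f p.1 - f p.2) ^+ 2)%:E)%E.

Definition energy_space : set (V -> R[i]) :=
  [set f | f (base G) = 0 /\ (energy f < +oo)%E].

(* Meaningful on [energy_space], where the energy is a finite real. *)
Definition energy_norm (f : V -> R[i]) : R := Num.sqrt (fine (energy f)).

Definition total_conductance (x : V) : R :=
  \sum_(y \in [set y | adj G x y]) conductance G x y.

End EnergySpace.

Definition delta (R : realType) (V : countType) (x : V) : V -> R[i] :=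
  \1_[set x].

(* Main.v *)
Require Import Defs.

Set Implicit Arguments.
Unset Strict Implicit.
Unset Printing Implicit Defensive.

Import Order.TTheory GRing.Theory Num.Theory.

Local Open Scope classical_set_scope.
Local Open Scope ring_scope.

(** The difference [delta x p.1 - delta x p.2] along an oriented edge [p] has
    modulus 1 if exactly one endpoint of [p] is [x], and vanishes otherwise.
    There are no loops, so the summands of the energy of [delta x] are the
    conductances of the edges leaving [x] plus those of the edges entering [x],
    with no edge of both kinds.  Each of the two families is indexed by the
    finitely many neighbours of [x], and by symmetry of the conductance each
    sums to the total conductance at [x]; the factor 1/2 in the energy makes up
    for this double counting. *)

Lemma delta_edge_energy (R : realType) (V : countType) (G : network R V)
    (x : V) (p : V * V) : edges G p ->
  conductance G p.1 p.2 * Normc.normc (delta R x p.1 - delta R x p.2) ^+ 2 =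
  (if p.1 == x then conductance G p.1 p.2 else 0) +
  (if p.2 == x then conductance G p.1 p.2 else 0).
Proof.
case: p => y z; rewrite /edges/= => yz; rewrite /delta !indicE !in_set1.
have [yx|_] := eqVneq y x; have [zx|_] := eqVneq z x.
- by move: yz; rewrite yx zx adj_irr.
- by rewrite subr0 Normc.normc1 expr1n mulr1 addr0.
- by rewrite sub0r normcN Normc.normc1 expr1n mulr1 add0r.
- by rewrite subr0 Normc.normc0 expr0n mulr0 addr0.
Qed.

Lemma edges_from (R : realType) (V : countType) (G : network R V) (x : V) :
  edges G `&` [set p | p.1 == x] = pair x @` [set y | adj G x y].
Proof.
apply/seteqP; split=> [[y z] /= [yz /eqP yx]|_ [y xy <-]] /=.
  by rewrite yx in yz *; exists z.
by split.
Qed.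

Lemma edges_to (R : realType) (V : countType) (G : network R V) (x : V) :
  edges G `&` [set p | p.2 == x] = (pair^~ x) @` [set y | adj G x y].
Proof.
apply/seteqP; split=> [[y z] /= [yz /eqP zx]|_ [y xy <-]] /=.
  by rewrite zx in yz *; exists y; rewrite //= adj_sym.
by split; rewrite // /edges/= adj_sym.
Qed.

Lemma esum_neighbours (R : realType) (V : countType) (G : network R V)
    (x : V) :
  (\esum_(y in [set y | adj G x y]) (conductance G x y)%:E)%E =
  (total_conductance G x)%:E.
Proof.
rewrite esum_fset; first by rewrite fsumEFin//; exact: adj_finite.
  exact: adj_finite.
by move=> y; rewrite inE lee_fin => /conductance_gt0/ltW.
Qed.

Lemma esum_edges_from (R : realType) (V : countType) (G : network R V)
    (x : V) :
  (\esum_(p in edges G) (if p.1 == x then conductance G p.1 p.2 else 0)%:E)%E =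
  (total_conductance G x)%:E.
Proof.
rewrite -esum_neighbours.
rewrite -(esum_image _ (pair x) (fun p => (conductance G p.1 p.2)%:E)).
  rewrite -edges_from esum_mkcondr; apply: eq_esum => p _.
  by rewrite mem_setE (fun_if EFin).
by move=> y z _ _ [].
Qed.

Lemma esum_edges_to (R : realType) (V : countType) (G : network R V)
    (x : V) :
  (\esum_(p in edges G) (if p.2 == x then conductance G p.1 p.2 else 0)%:E)%E =
  (total_conductance G x)%:E.
Proof.
rewrite -esum_neighbours.
under [RHS]eq_esum => y xy do rewrite (conductance_sym xy).
rewrite -(esum_image _ (pair^~ x) (fun p => (conductance G p.1 p.2)%:E)).
  rewrite -edges_to esum_mkcondr; apply: eq_esum => p _.
  by rewrite mem_setE (fun_if EFin).
by move=> y z _ _ [].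
Qed.

(** This holds at the base point too; only membership in the energy space
    requires [x] to differ from it. *)
Lemma energy_delta (R : realType) (V : countType) (G : network R V) (x : V) :
  energy G (delta R x) = (total_conductance G x)%:E.
Proof.
have c_ge0 (b : bool) p : edges G p ->
    (0 <= (if b then conductance G p.1 p.2 else 0)%:E)%E.
  by case: b => // /conductance_gt0/ltW; rewrite lee_fin.
rewrite /energy (eq_esum (fun p Gp => congr1 EFin (delta_edge_energy x Gp))).
under eq_esum => p _ do rewrite EFinD.
rewrite esumD => [|p|p]; [|exact: c_ge0|exact: c_ge0].
rewrite esum_edges_from esum_edges_to -EFinD -EFinM.
by rewrite mulrDr [2^-1 * _]mulrC -splitr.
Qed.

Theorem proposition4p4 (R : realType) (V : countType) (G : network R V)
    (x : V) (hx : x <> base G) :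
  energy_space G (delta R x) /\
  energy_norm G (delta R x) ^+ 2 = total_conductance G x.
Proof.
split.
  split; last by rewrite energy_delta ltry.
  by rewrite /delta indicE memNset// => /esym.
rewrite /energy_norm energy_delta sqr_sqrtr//= -lee_fin -esum_neighbours.
by apply: esum_ge0 => y /conductance_gt0/ltW; rewrite lee_fin.
Qed.
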